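(* Let $\lambda=([0,1],\kappa)$ be a flat curve. Then the Hausdorff dimension of $\lambda$ (with respect to $\kappa$) is equal to $1$.
   Context: A quasi-metric on $[0,1]$ is a symmetric function $\kappa:[0,1]^2\to[0,\infty)$, vanishing exactly on the diagonal, with $\kappa(A,C)\le c(\kappa(A,B)+\kappa(B,C))$ for some constant $c\ge1$. The curve $\lambda=([0,1],\kappa)$ is called a flat curve if $\kappa$ is a quasi-metric on $[0,1]$, continuous with respect to the usual topology, such that $$|\kappa(A,B)+\kappa(B,C)-\kappa(A,C)|\le m(\kappa(A,C))\,\kappa(A,C)\quad\text{for all }0\le A\le B\le C\le1,$$ where $m:[0,\infty)\to[0,\infty)$ is non-decreasing and $m(t)\searrow0$ as $t\searrow0$. Hausdorff measures are $\mathcal H^k_\kappa(E)=\lim_{\varepsilon\to0}\inf\{\sum_i(\operatorname{diam}_\kappa E_i)^k: E\subset\bigcup_iE_i,\ \operatorname{diam}_\kappa E_i\le\varepsilon\}$, and the Hausdorff dimension is defined from them as usual. *)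

(* Defs.v *)
From HB Require Import structures.
From mathcomp Require Import all_boot all_order all_algebra.
From mathcomp Require Import all_classical all_reals all_analysis.

Set Implicit Arguments.
Unset Strict Implicit.
Unset Printing Implicit Defensive.

Import Order.TTheory GRing.Theory Num.Theory.
Import numFieldNormedType.Exports.

Local Open Scope classical_set_scope.
Local Open Scope ring_scope.

Section QuasiMetric.
Context {R : realType} {T : Type}.
Implicit Types (X E : set T) (d : T -> T -> R) (k eps : R).

(* A function on [X] is represented by a total function on [T], of which only
   the values at points of [X] are constrained. *)
Definition quasi_metric X d : Prop :=
  [/\ forall x y, X x -> X y -> 0 <= d x y,
      forall x y, X x -> X y -> d x y = d y x,
      forall x y, X x -> X y -> (d x y = 0 <-> x = y) &
      exists2 c : R, 1 <= c &
        forall x y z, X x -> X y -> X z -> d x z <= c * (d x y + d y z)].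

(* This is [-oo] on the empty set, which [hausdorff_gauge] treats apart. *)
Definition diameter d E : \bar R :=
  ereal_sup [set (d p.1 p.2)%:E | p in E `*` E].

(* The empty set contributes [0] even for [k = 0], while a nonempty set of
   diameter [0] then contributes [0 `^ 0 = 1]. Hence finite covers can be padded
   with empty sets, and [hausdorff_measure] at [k = 0] is the counting
   measure. *)
Definition hausdorff_gauge d k E : \bar R :=
  if `[< E = set0 >] then 0%E else poweR (diameter d E) k.

Definition hausdorff_cover X d eps E : set ((set T)^nat) :=
  [set F | [/\ forall i, F i `<=` X,
               E `<=` \bigcup_i F i &
               forall i, (diameter d (F i) <= eps%:E)%E]].

Definition hausdorff_premeasure X d k eps E : \bar R :=
  ereal_inf [set (\sum_(0 <= i <oo) hausdorff_gauge d k (F i))%E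
            | F in hausdorff_cover X d eps E].

Definition hausdorff_measure X d k E : \bar R :=
  lim (hausdorff_premeasure X d k eps E @[eps --> 0^'+]).

Definition hausdorff_dim X d : \bar R :=
  ereal_inf [set k%:E | k in [set k | 0 <= k /\ hausdorff_measure X d k X = 0%E]].

End QuasiMetric.

Definition flat_curve (R : realType) (kappa : R -> R -> R) : Prop :=
  [/\ quasi_metric `[0, 1] kappa,
      {within `[0, 1] `*` `[0, 1],
        continuous (fun p : R * R => kappa p.1 p.2)} &
      exists m : R -> R,
        [/\ forall t, 0 <= t -> 0 <= m t,
            forall s t, 0 <= s -> s <= t -> m s <= m t,
            m t @[t --> 0^'+] --> (0 : R) &
            forall a b c, 0 <= a -> a <= b -> b <= c -> c <= 1 ->
              `|kappa a b + kappa b c - kappa a c|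
                <= m (kappa a c) * kappa a c]].

(* Main.v *)
Require Import Defs.
From mathcomp Require Import all_boot all_order all_algebra.
From mathcomp Require Import all_classical all_reals all_analysis.
From mathcomp Require Import ring lra.

(* Where kappa is small it is additive along the curve up to a factor 1 +- eta,
   so splitting an arc at the point equidistant from its ends multiplies its
   diameter by a factor rho close to 1/2.

   If k > 1, then 2 rho^k < 1 for eta small, and iterated splitting yields
   covers whose sums of k-th powers of diameters decrease geometrically.

   If 0 <= k < 1, then rho^k >= 1/2 for eta small, so the parametrization psi of
   a short arc by dyadic splitting satisfies |s - t| <= C kappa(psi s, psi t)^k.
   Pulling a cover back along psi bounds its sum from below by the Lebesgue
   measure of [0, 1]. *)

Set Implicit Arguments.
Unset Strict Implicit.
Unset Printing Implicit Defensive.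

Import Order.TTheory GRing.Theory Num.Theory.
Import numFieldNormedType.Exports.

Local Open Scope classical_set_scope.
Local Open Scope ring_scope.

(** * Local geometry of flat curves *)

Section FlatCurve.
Context {R : realType} (kappa : R -> R -> R) (hflat : flat_curve kappa).
Implicit Types (a b c x y s t k e f : R).

Lemma kappa_ge0 x y : 0 <= x <= 1 -> 0 <= y <= 1 -> 0 <= kappa x y.
Proof.
move=> hx hy; have [[h _ _ _] _ _] := hflat.
by apply: h; rewrite /= in_itv /= ?hx ?hy.
Qed.

Lemma kappaC x y : 0 <= x <= 1 -> 0 <= y <= 1 -> kappa x y = kappa y x.
Proof.
move=> hx hy; have [[_ h _ _] _ _] := hflat.
by apply: h; rewrite /= in_itv /= ?hx ?hy.
Qed.

Lemma kappa_eq0 x y : 0 <= x <= 1 -> 0 <= y <= 1 -> kappa x y = 0 -> x = y.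
Proof.
move=> hx hy k0; have [[_ _ h _] _ _] := hflat.
by apply/h; rewrite /= ?in_itv /= ?hx ?hy.
Qed.

Lemma kappaxx x : 0 <= x <= 1 -> kappa x x = 0.
Proof.
move=> hx; have [[_ _ h _] _ _] := hflat.
by apply/h; rewrite /= ?in_itv /= ?hx.
Qed.

Lemma kappa_continuous_r x : 0 <= x <= 1 ->
  {within `[0, 1], continuous (kappa x)}.
Proof.
move=> hx; have [_ + _] := hflat.
move=> /subspace_continuousP h; apply/subspace_continuousP => y yI.
have xI : `[0 : R, 1]%classic x by rewrite /= in_itv /= hx.
have {}h := h (x, y) (conj xI yI).
apply: (cvg_comp (fun z => (x, z)) (fun p => kappa p.1 p.2)) h.
move=> A /=; rewrite /within /= => -[[U V]] /= [Ux Vy] UV.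
apply: filterS Vy => z Vz zI.
by apply: (UV (x, z)) => //=; split => //=; exact: nbhs_singleton.
Qed.

Lemma kappa_near x d : 0 <= x <= 1 -> 0 < d ->
  exists2 r : R, 0 < r &
    forall y, 0 <= y <= 1 -> `|x - y| < r -> kappa x y <= d.
Proof.
move=> hx d0; have /subspace_continuousP h := kappa_continuous_r hx.
have xI : `[0 : R, 1]%classic x by rewrite /= in_itv /= hx.
have /cvgrPdist_le/(_ _ d0) := h x xI.
rewrite /within /= => /nbhs_ballP[r /= r0 hr].
exists r => // y hy xy.
have := hr y xy; rewrite /= in_itv /= => /(_ hy).
rewrite /from_subspace kappaxx // sub0r normrN; exact: le_trans (ler_norm _).
Qed.

(** Intermediate value theorem for the difference of the distances to [a] and to [b], which is
    nonpositive at [a] and nonnegative at [b]. *)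
Lemma kappa_midpoint a b : 0 <= a -> a <= b -> b <= 1 ->
  exists2 c, a <= c <= b & kappa a c = kappa c b.
Proof.
move=> a0 ab b1.
have ha : 0 <= a <= 1 by lra.
have hb : 0 <= b <= 1 by lra.
have abI : `[a, b] `<=` `[0 : R, 1].
  by move=> x /=; rewrite !in_itv /=; lra.
have cont : {within `[a, b], continuous (kappa a - kappa b)}.
  apply: within_continuousB;
    exact: continuous_subspaceW (kappa_continuous_r _).
have [|c] := @IVT R (kappa a - kappa b) a b 0 ab cont.
  rewrite /= !fctE !kappaxx // sub0r subr0 (kappaC hb ha) ge_min le_max.
  by rewrite oppr_le0 !kappa_ge0 // orbT.
rewrite in_itv /= => hc /eqP; rewrite subr_eq0 => /eqP e.
by exists c => //; rewrite e kappaC //; lra.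
Qed.

Lemma kappa_almost_additive eta : 0 < eta ->
  exists2 d : R, 0 < d &
    forall a b c, 0 <= a -> a <= b -> b <= c -> c <= 1 -> kappa a c <= d ->
      `|kappa a b + kappa b c - kappa a c| <= eta * kappa a c.
Proof.
move=> eta0; have [_ _ [m [m0 mmono m_cvg hm]]] := hflat.
have /cvgrPdist_le/(_ _ eta0) := m_cvg.
rewrite /at_right /within /= => /nbhs_ballP[r /= r0 hr].
exists (r / 2) => [|a b c a0 ab bc c1 acr]; first by rewrite divr_gt0.
have k0 : 0 <= kappa a c by apply: kappa_ge0; lra.
apply: le_trans (hm a b c a0 ab bc c1) _.
(* The limit at [0^'+] does not see [m 0], so a vanishing distance is treated apart. *)
have [-> |kn0] := eqVneq (kappa a c) 0; first by rewrite !mulr0.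
have kp : 0 < kappa a c by rewrite lt_def kn0.
rewrite ler_wpM2r //.
have /(_ _ kp) := hr (kappa a c).
rewrite /ball /= !sub0r !normrN (gtr0_norm kp) => h.
apply: le_trans (h _); last by lra.
exact: ler_norm.
Qed.

(** The last clause stands in for monotonicity of the distance under inclusion of arcs. Almost
    additivity with [eta <= 1] is used twice and costs a factor 2 each time: from [[a, b]] to
    [[a, y]], then to [[x, y]]. *)
Lemma kappa_local eta : 0 < eta -> eta <= 1 ->
  exists d : R, [/\ 0 < d,
    forall a b c, 0 <= a -> a <= b -> b <= c -> c <= 1 -> kappa a c <= d ->
      `|kappa a b + kappa b c - kappa a c| <= eta * kappa a c &
    forall a x y b, 0 <= a -> a <= x -> x <= y -> y <= b -> b <= 1 ->
      kappa a b <= d -> kappa x y <= 4 * kappa a b].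
Proof.
move=> eta0 eta1; have [d d0 hd] := kappa_almost_additive eta0.
(* Halved so that [kappa a y <= 2 * kappa a b] stays in the range where additivity applies again. *)
exists (d / 2); split=> [|a b c a0 ab bc c1 acd|a x y b a0 ax xy yb b1 abd].
- by rewrite divr_gt0.
- by apply: hd => //; lra.
have kab : 0 <= kappa a b by apply: kappa_ge0; lra.
have kax : 0 <= kappa a x by apply: kappa_ge0; lra.
have kay : 0 <= kappa a y by apply: kappa_ge0; lra.
have kyb : 0 <= kappa y b by apply: kappa_ge0; lra.
have eab : eta * kappa a b <= kappa a b by rewrite ler_piMl.
have eay : eta * kappa a y <= kappa a y by rewrite ler_piMl.
have /ler_normlW h1 : `|kappa a y + kappa y b - kappa a b| <= eta * kappa a b.
  by apply: hd => //; lra.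
have /ler_normlW h2 : `|kappa a x + kappa x y - kappa a y| <= eta * kappa a y.
  by apply: hd => //; lra.
lra.
Qed.

(** * Fine covers *)

(** Arcs are measured by the distance of their endpoints rather than by their diameter, and may
    stick out of [[a, b]]. With finite lists, covers of adjacent arcs can be concatenated. *)
Definition fine_cover k e f a b := exists s : seq (R * R),
  [/\ forall p, p \in s ->
        [/\ 0 <= p.1, p.1 <= p.2, p.2 <= 1 & kappa p.1 p.2 <= e],
      forall x, a <= x <= b -> exists2 p, p \in s & p.1 <= x <= p.2 &
      \sum_(p <- s) kappa p.1 p.2 `^ k <= f].

Lemma fine_cover_cat k e f g a b c :
  fine_cover k e f a b -> fine_cover k e g b c -> fine_cover k e (f + g) a c.
Proof.
move=> [s [s1 s2 s3]] [t [t1 t2 t3]]; exists (s ++ t); split.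
- by move=> p; rewrite mem_cat => /orP[/s1|/t1].
- move=> x /andP[ax xc]; have [xb|bx] := leP x b.
    by have [|p ps px] := s2 x; [rewrite ax|exists p; rewrite ?mem_cat ?ps].
  have [|p pt px] := t2 x; first by rewrite (ltW bx).
  by exists p; rewrite ?mem_cat ?pt ?orbT.
- by rewrite big_cat lerD.
Qed.

Lemma fine_coverW k e e' f f' a b : e <= e' -> f <= f' ->
  fine_cover k e f a b -> fine_cover k e' f' a b.
Proof.
move=> ee ff [s [s1 s2 s3]]; exists s; split => //.
- by move=> p /s1[? ? ?] /le_trans; split => //; auto.
- exact: le_trans ff.
Qed.

(** Splitting at the equidistant point gives two arcs of equal endpoint distance, at most [rho]
    times the old one, so the bound on the sum of k-th powers is multiplied by 2 rho^k. Since
    [rho <= 1], the halves stay below [d] and the induction continues. *)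
Lemma fine_cover_bisect k rho d : 0 <= k -> 0 <= rho -> rho <= 1 ->
  (forall a b c, 0 <= a -> a <= b -> b <= c -> c <= 1 -> kappa a c <= d ->
    kappa a b = kappa b c -> kappa a b <= rho * kappa a c) ->
  forall n a b, 0 <= a -> a <= b -> b <= 1 -> kappa a b <= d ->
  fine_cover k (rho ^+ n * kappa a b)
    ((2 * rho `^ k) ^+ n * kappa a b `^ k) a b.
Proof.
move=> k0 rho0 rho1 hrho; elim=> [|n IH] a b a0 ab b1 abd.
  exists [:: (a, b)]; split=> [p|x xab|].
  - by rewrite inE => /eqP -> /=; rewrite mul1r.
  - by exists (a, b); rewrite ?inE.
  - by rewrite big_seq1 mul1r.
have [c /andP[ac cb] e] := kappa_midpoint a0 ab b1.
have kab : 0 <= kappa a b by apply: kappa_ge0; lra.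
have kac : 0 <= kappa a c by apply: kappa_ge0; lra.
have h1 : kappa a c <= rho * kappa a b by exact: hrho.
have h2 : kappa a c <= d.
  by apply: le_trans h1 _; apply: le_trans abd; rewrite ler_piMl.
have h1k : kappa a c `^ k <= rho `^ k * kappa a b `^ k.
  by rewrite -powRM // ge0_ler_powR // nnegrE mulr_ge0.
have -> : (2 * rho `^ k) ^+ n.+1 * kappa a b `^ k =
    (2 * rho `^ k) ^+ n * (rho `^ k * kappa a b `^ k) +
    (2 * rho `^ k) ^+ n * (rho `^ k * kappa a b `^ k).
  by rewrite exprS; ring.
have q0 : 0 <= (2 * rho `^ k) ^+ n by rewrite exprn_ge0 // mulr_ge0 // powR_ge0.
apply: (@fine_cover_cat _ _ _ _ _ c).
  apply: fine_coverW (IH a c _ _ _ _) => //; last lra.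
    by rewrite exprSr -mulrA ler_wpM2l // exprn_ge0.
  by rewrite ler_wpM2l.
apply: fine_coverW (IH c b _ _ _ _) => //; rewrite -?e //; last lra.
  by rewrite exprSr -mulrA ler_wpM2l // exprn_ge0.
by rewrite ler_wpM2l.
Qed.

Lemma expr_lt_near (q e : R) : 0 <= q -> q < 1 -> 0 < e ->
  exists N, forall n, (N <= n)%N -> q ^+ n <= e.
Proof.
move=> q0 q1 e0; have /cvg_expr/cvgrPdist_le/(_ _ e0)[N _ hN] : `|q| < 1.
  by rewrite ger0_norm.
exists N => n /hN /=; rewrite sub0r normrN; exact: le_trans (ler_norm _).
Qed.

Lemma fine_cover_short k : 1 < k ->
  exists2 d, 0 < d & forall a b, 0 <= a -> a <= b -> b <= 1 -> kappa a b <= d ->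
    forall e, 0 < e -> fine_cover k e e a b.
Proof.
(* The exponent 2 / (k + 1) lies strictly between 1 / k and 1, which gives both 2 rho^k < 1 and 1/2
   < rho < 1. *)
move=> k1; pose rho : R := 2 `^ (- (2 / (k + 1))).
have k10 : 0 < k + 1 by lra.
have t1 : 2 / (k + 1) < 1 by rewrite ltr_pdivrMr //; lra.
have rho_gt : 2^-1 < rho.
  rewrite -[2^-1]powR_inv1 // /rho /powR pnatr_eq0 /= ltr_expR.
  by rewrite ltr_pM2r ?ln_gt0 //; lra.
have rho_lt : rho < 1.
  rewrite -[1](@powRr0 R 2) /rho /powR pnatr_eq0 /= ltr_expR.
  by rewrite ltr_pM2r ?oppr_lt0 ?divr_gt0 ?ln_gt0 ?ltr1n.
have q_lt : 2 * rho `^ k < 1.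
  rewrite -{1}[2]powRr1 // /rho -powRrM -powRD; last first.
    by rewrite pnatr_eq0 implybT.
  rewrite -[ltRHS](@powRr0 R 2) /powR pnatr_eq0 /= ltr_expR.
  rewrite ltr_pM2r ?ln_gt0 ?ltr1n //.
  have -> : 1 + - (2 / (k + 1)) * k = (1 - k) / (k + 1) by field; lra.
  by rewrite ltr_pdivrMr //; lra.
have q_ge : 0 <= 2 * rho `^ k by rewrite mulr_ge0 ?powR_ge0.
(* With eta = 2 rho - 1, an equidistant point c satisfies 2 kappa a c <= (1 + eta) kappa a b = 2 rho
   kappa a b. *)
have [||d [d0 hadd _]] := @kappa_local (2 * rho - 1); [lra..|].
exists d => // a b a0 ab b1 abd e e0.
have kab : 0 <= kappa a b by apply: kappa_ge0; lra.
(* [N1] controls the mesh and [N2] the sum of powers; the added 1 keeps the denominators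
   positive. *)
have [||N1 h1] := @expr_lt_near rho (e / (1 + kappa a b)) _ rho_lt.
- lra.
- by rewrite divr_gt0 //; lra.
have kabk := powR_ge0 (kappa a b) k.
have [|N2 h2] := @expr_lt_near _ (e / (1 + kappa a b `^ k)) q_ge q_lt.
  by rewrite divr_gt0 //; lra.
apply: fine_coverW
  (@fine_cover_bisect k rho d _ _ _ _ (N1 + N2)%N a b _ _ _ _) => //; try lra.
- have := h1 (N1 + N2)%N (leq_addr _ _); rewrite ler_pdivlMr; last lra.
  by apply: le_trans; rewrite ler_wpM2l ?exprn_ge0 //; lra.
- have := h2 (N1 + N2)%N (leq_addl _ _); rewrite ler_pdivlMr; last lra.
  by apply: le_trans; rewrite ler_wpM2l ?exprn_ge0 //; lra.
move=> x z y x0 xz zy y1 xyd e'.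
have /ler_normlW := hadd x z y x0 xz zy y1 xyd.
by rewrite -e'; lra.
Qed.

(** Continuity makes nearby points [d]-close, so short arcs can be chained from 0 to 1; a supremum
    argument replaces the extraction of a finite chain. *)
Lemma fine_cover_unit k e : 1 < k -> 0 < e -> fine_cover k e e 0 1.
Proof.
move=> k1 e0; have [d d0 hd] := fine_cover_short k1.
(* All [e] at once, so that appending an arc may spend [f / 2] on each part. *)
pose good b := forall e, 0 < e -> fine_cover k e e 0 b.
have good_step b c : 0 <= b -> b <= c -> c <= 1 -> kappa b c <= d ->
    good b -> good c.
  move=> b0 bc c1 bcd gb f f0.
  have f20 : 0 < f / 2 by rewrite divr_gt0.
  have := fine_cover_cat (gb _ f20) (hd _ _ b0 bc c1 bcd _ f20).
  by apply: fine_coverW; lra.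
have good0 : good 0 by apply: hd; rewrite ?kappaxx //; lra.
pose S := [set b | [/\ 0 <= b, b <= 1 & good b]].
have S0 : S 0 by split.
have supS : has_sup S by split; [exists 0|exists 1 => b [_ ? _]].
have s0 : 0 <= sup S by exact: sup_upper_bound.
have s1 : sup S <= 1 by apply: ge_sup; [exists 0|move=> b []].
have [|r r0 hr] := @kappa_near (sup S) d _ d0; first lra.
have [b [b0 b1 gb] bs] := sup_adherent r0 supS.
have bs' : b <= sup S by exact: sup_upper_bound.
(* The supremum is itself good, being reached by one short arc from a good point. *)
have gs : good (sup S).
  apply: (good_step b) => //; rewrite kappaC; [|lra..].
  by apply: hr; [lra|rewrite ger0_norm; lra].
(* If there is room beyond the supremum, one more arc of length [r / 2] contradicts maximality;
   otherwise such an arc reaches 1. *)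
have [h|h] := leP (sup S + r / 2) 1.
  have gy : S (sup S + r / 2).
    split=> //; first lra.
    apply: (good_step (sup S)) => //; first lra.
    by apply: hr; [lra|rewrite ler0_norm; lra].
  by have := sup_upper_bound supS gy; lra.
suff : good 1 by apply.
apply: (good_step (sup S)) => //.
by apply: hr; [lra|rewrite ler0_norm; lra].
Qed.

(** * Parametrization by dyadic bisection *)

Section Bisection.
Variable mid : R -> R -> R.
Hypothesis mid_spec : forall a b, 0 <= a -> a <= b -> b <= 1 ->
  a <= mid a b <= b /\ kappa a (mid a b) = kappa (mid a b) b.

(** The j-th division point of level n, standing for the dyadic number j / 2^n: even indices come
    from the previous level, odd ones are new midpoints. Indices from 2^n on give [b], so [j] needs
    no bound. *)
Fixpoint bisection a b (n j : nat) : R :=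
  if n is n'.+1 then
    if odd j then mid (bisection a b n' j./2) (bisection a b n' j./2.+1)
    else bisection a b n' j./2
  else if j == 0%N then a else b.

Variables a b : R.
Hypotheses (a_ge0 : 0 <= a) (leab : a <= b) (b_le1 : b <= 1).
Local Notation P := (bisection a b).

Lemma bisection_step n j : [/\ a <= P n j, P n j <= P n j.+1 & P n j.+1 <= b].
Proof.
elim: n j => [|n IH] j /=; first by case: ifP.
move: (IH j./2); rewrite uphalf_half.
case: (odd j); rewrite /= ?add0n ?add1n;
  move: (P n j./2) (P n j./2.+1) => x y [h1 h2 h3];
have [a0 b1] := (a_ge0, b_le1);
  by have [|||/andP[m1 m2] _] := @mid_spec x y; (try split); lra.
Qed.

Lemma bisection_itv n j : a <= P n j <= b.
Proof. by have [-> h1 h2] := bisection_step n j; exact: le_trans h2. Qed.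

Lemma bisection_le n i j : (i <= j)%N -> P n i <= P n j.
Proof.
move/subnK <-; elim: (j - i)%N => // m; rewrite addSn => /le_trans; apply.
by have [] := bisection_step n (m + i)%N.
Qed.

(** Makes the point depend on the dyadic number j / 2^n alone, so that points of different levels
    can be compared. *)
Lemma bisection_refine n m j : P (n + m)%N (j * 2 ^ m)%N = P n j.
Proof.
elim: m => [|m IH]; first by rewrite addn0 muln1.
by rewrite addnS expnSr mulnA muln2 /= odd_double doubleK.
Qed.

(** Both halves of a split have the same endpoint distance, so a lower bound on the left one serves
    for both. *)
Lemma bisection_kappa rho : 0 <= rho ->
  (forall x c y, a <= x -> x <= c -> c <= y -> y <= b ->
    kappa x c = kappa c y -> rho * kappa x y <= kappa x c) ->
  forall n j, (j < 2 ^ n)%N -> rho ^+ n * kappa a b <= kappa (P n j) (P n j.+1).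
Proof.
move=> rho0 hrho; elim=> [|n IH] j.
  by rewrite expn0 ltnS leqn0 => /eqP -> /=; rewrite mul1r.
move=> jn; have jn2 : (j./2 < 2 ^ n)%N.
  rewrite -ltn_double -[(2 ^ n).*2]mul2n -expnS (leq_ltn_trans _ jn) //.
  by rewrite -{2}(odd_double_half j) leq_addl.
have {IH} := IH _ jn2; have := bisection_step n j./2; rewrite /= uphalf_half.
move=> h IHj; have [x [y [ex ey h0 IHxy]]] : exists x y, [/\ P n j./2 = x,
    P n j./2.+1 = y, [/\ a <= x, x <= y & y <= b] &
    rho ^+ n * kappa a b <= kappa x y] by exists (P n j./2), (P n j./2.+1).
have [h1 h2 h3] := h0; have [a0 b1] := (a_ge0, b_le1).
have [|||/andP[m1 m2] e] := @mid_spec x y; [lra..|].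
have hx : rho ^+ n.+1 * kappa a b <= kappa x (mid x y).
  apply: le_trans (hrho _ _ y _ _ _ _ _) => //.
  by rewrite exprS -mulrA ler_wpM2l.
by case: (odd j); rewrite /= ?add0n ?add1n ex ey -?e.
Qed.

(** Monotone extension of the map from j / 2^n to [P n j] to all real [t], as a supremum over the
    dyadic numbers below [t]. *)
Definition bisection_param t := sup [set P p.1 p.2 | p in
  [set p : nat * nat | p.2%:R <= t * 2 ^+ p.1]].
Local Notation psi := bisection_param.

Lemma bisection_param_has_sup t : 0 <= t ->
  has_sup [set P p.1 p.2 | p in [set p : nat * nat | p.2%:R <= t * 2 ^+ p.1]].
Proof.
move=> t0; split; first by exists a; exists (0, 0)%N; rewrite //= mulr1.
by exists b => _ [p _ <-]; case/andP: (bisection_itv p.1 p.2).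
Qed.

Lemma le_bisection_param t n j : 0 <= t -> j%:R <= t * 2 ^+ n -> P n j <= psi t.
Proof.
move=> t0 jt; apply: sup_upper_bound; first exact: bisection_param_has_sup.
by exists (n, j).
Qed.

Lemma ge_bisection_param t n j : 0 <= t -> t * 2 ^+ n <= j%:R -> psi t <= P n j.
Proof.
move=> t0 tj; apply: ge_sup; first by have [] := bisection_param_has_sup t0.
move=> _ [[m i] /= it <-].
(* Both dyadic numbers are brought to the common level m + n. *)
rewrite -(bisection_refine m n) -(bisection_refine n m) addnC bisection_le //.
rewrite -(ler_nat R) !natrM !natrX.
apply: (@le_trans _ _ (t * 2 ^+ m * 2 ^+ n)).
  by rewrite ler_wpM2r ?exprn_ge0.
by rewrite mulrAC ler_wpM2r ?exprn_ge0.
Qed.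

Lemma bisection_param_itv t : 0 <= t <= 1 -> a <= psi t <= b.
Proof.
move=> /andP[t0 t1]; apply/andP; split.
  by have := @le_bisection_param t 0 0 t0; apply; rewrite mulr1.
by have := @ge_bisection_param t 0 1 t0; apply; rewrite mulr1.
Qed.

(** Take the least n with (t - s) 2^n >= 2. A whole dyadic interval of level n then fits between s
    and t, while minimality gives t - s <= 4 / 2^n. *)
Lemma bisection_param_gap s t : 0 <= s -> s < t -> t <= 1 -> exists n j,
  [/\ (j < 2 ^ n)%N, t - s <= 4 * 2^-1 ^+ n,
      psi s <= P n j & P n j.+1 <= psi t].
Proof.
move=> s0 st t1.
have ex : exists n, 2 <= (t - s) * 2 ^+ n.
  have [|||n /(_ n (leqnn n))] := @expr_lt_near 2^-1 ((t - s) / 2); [lra..|].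
  rewrite exprVn => h; exists n; move: h.
  by rewrite ler_pdivlMr // ler_pdivrMl ?exprn_gt0 // mulrC.
case: (ex_minnP ex) => n hn nmin.
have n2 : 0 < 2 ^+ n :> R by rewrite exprn_gt0.
have sn0 : 0 <= s * 2 ^+ n by rewrite mulr_ge0 // ltW.
have /andP[tr1 tr2] := truncn_itv sn0.
set j := Num.truncn _ in tr1 tr2.
have jt : j.+2%:R <= t * 2 ^+ n.
  by move: hn; rewrite mulrBl -[j.+2]addn2 natrD; move: tr1; lra.
(* [j] is the integer part of s 2^n, so the first dyadic number surely beyond s has index [j.+1]. *)
exists n, j.+1; split.
- rewrite -(ltr_nat R) natrX; move: jt; rewrite -[j.+2]addn1 natrD.
  by have : t * 2 ^+ n <= 2 ^+ n; [rewrite ler_piMl // ltW|lra].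
- case: n {hn n2 sn0 tr1 tr2 j jt} nmin => [|n] nmin.
    by rewrite expr0; lra.
  have : ~~ (2 <= (t - s) * 2 ^+ n) by apply/negP => /nmin; rewrite ltnn.
  rewrite -ltNge exprS exprVn => h.
  have n2 : 0 < 2 ^+ n :> R by rewrite exprn_gt0.
  by move: h; rewrite -ltr_pdivlMr //; lra.
- by apply: ge_bisection_param => //; rewrite ltW.
- by apply: le_bisection_param => //; lra.
Qed.

End Bisection.

(** Between psi s and psi t lies an arc of some level n with t - s <= 4 / 2^n and endpoint distance
    at least rho^n kappa 0 b. As rho^k >= 1/2, the k-th power of that distance dominates 2^-n up to
    a constant. *)
Lemma hoelder_param k : 0 <= k -> k < 1 -> exists (psi : R -> R) (C d : R),
  [/\ 0 < C, 0 < d, forall t, 0 <= t <= 1 -> 0 <= psi t <= 1 &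
    forall s t, 0 <= s -> s <= t -> t <= 1 -> kappa (psi s) (psi t) <= d ->
      t - s <= C * kappa (psi s) (psi t) `^ k].
Proof.
(* Here rho < 1/2 because k < 1, and rho^k >= 1/2 amounts to k (k - 2) >= -1, that is (k - 1)^2 >=
   0. *)
move=> k0 k1; pose rho : R := 2 `^ (k - 2).
have rho_gt0 : 0 < rho by rewrite powR_gt0.
have rho_lt : rho < 2^-1.
  rewrite -[2^-1]powR_inv1 // /rho /powR pnatr_eq0 /= ltr_expR.
  by rewrite ltr_pM2r ?ln_gt0 ?ltr1n //; lra.
have rhok : 2^-1 <= rho `^ k.
  rewrite -[2^-1]powR_inv1 // /rho -powRrM /powR pnatr_eq0 /= ler_expR.
  rewrite ler_pM2r ?ln_gt0 ?ltr1n //.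
  by have := sqr_ge0 (k - 1); rewrite expr2; lra.
clearbody rho.
(* With eta = 1 - 2 rho, an equidistant c satisfies 2 kappa x c >= (1 - eta) kappa x y = 2 rho kappa
   x y. Taking [kappa 0 b <= d / 4] below brings every subarc of [[0, b]] within range. *)
have [||d [d0 hadd hsub]] := @kappa_local (1 - 2 * rho); [lra..|].
have [||r r0 hr] := @kappa_near 0 (d / 4); [lra..|].
pose b := Num.min (r / 2) 1.
have b0 : 0 < b by rewrite lt_min ltr01 andbT divr_gt0.
have b1 : b <= 1 by rewrite ge_min lexx orbT.
have br : b <= r / 2 by rewrite ge_min lexx.
have kb : kappa 0 b <= d / 4 by apply: hr; [lra|rewrite ler0_norm; lra].
have kb0 : 0 < kappa 0 b.
  rewrite lt_def kappa_ge0 ?andbT; [|lra..].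
  by apply/eqP => /kappa_eq0 e; have : 0 = b by [apply: e; lra]; lra.
have [p|mid0 mid0P] := @choice (R * R) R (fun p c => 0 <= p.1 -> p.1 <= p.2 ->
    p.2 <= 1 -> p.1 <= c <= p.2 /\ kappa p.1 c = kappa c p.2).
  have [[[h1 h2] h3]|h] := pselect ((0 <= p.1 /\ p.1 <= p.2) /\ p.2 <= 1).
    by have [c c1 c2] := kappa_midpoint h1 h2 h3; exists c.
  by exists 0 => h1 h2 h3; case: h.
pose mid x y := mid0 (x, y).
have midP x y : 0 <= x -> x <= y -> y <= 1 ->
    x <= mid x y <= y /\ kappa x (mid x y) = kappa (mid x y) y.
  exact: (mid0P (x, y)).
exists (bisection_param mid 0 b), (4 * (4 / kappa 0 b) `^ k), d; split => //.
- by rewrite mulr_gt0 // powR_gt0 // divr_gt0.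
- by move=> t ht; have := bisection_param_itv midP (lexx 0) (ltW b0) b1 ht; lra.
move=> s t s0; rewrite le_eqVlt => /orP[/eqP ->|st] t1 kd.
  by rewrite subrr !mulr_ge0 ?powR_ge0.
have hs : 0 <= s <= 1 by lra.
have ht : 0 <= t <= 1 by lra.
have := bisection_param_itv midP (lexx 0) (ltW b0) b1 hs.
have := bisection_param_itv midP (lexx 0) (ltW b0) b1 ht.
have [n [j [jn ts]]] := bisection_param_gap midP (lexx 0) (ltW b0) b1 s0 st t1.
have [_ + _] := bisection_step midP (lexx 0) (ltW b0) b1 n j.
have : rho ^+ n * kappa 0 b <=
    kappa (bisection mid 0 b n j) (bisection mid 0 b n j.+1).
  apply: bisection_kappa => //; [exact: ltW..|].
  move=> x c y x0 xc cy yb e.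
  have kxy : kappa x y <= 4 * kappa 0 b by apply: hsub => //; lra.
  have : `|kappa x c + kappa c y - kappa x y| <= (1 - 2 * rho) * kappa x y.
    by apply: hadd => //; lra.
  by rewrite ler_norml -e => /andP[]; lra.
move: kd.
set x := bisection_param _ _ _ s; set y := bisection_param _ _ _ t.
set p := bisection _ _ _ _ j; set q := bisection _ _ _ _ j.+1.
move=> kd kpq pq xp qy hy hx.
have kpq4 : kappa p q <= 4 * kappa x y by apply: hsub => //; lra.
have kxy : 0 <= kappa x y by apply: kappa_ge0; lra.
have : rho ^+ n <= 4 / kappa 0 b * kappa x y.
  by rewrite mulrAC ler_pdivlMr //; lra.
have rn0 : 0 <= rho ^+ n by rewrite exprn_ge0 // ltW.
have c0 : 0 <= 4 / kappa 0 b by rewrite divr_ge0 // ltW.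
move=> /(ge0_ler_powR k0); rewrite !nnegrE mulr_ge0 // => /(_ rn0 isT).
rewrite powRM // => h.
have h2 : 2^-1 ^+ n <= (rho ^+ n) `^ k.
  have -> : (rho ^+ n) `^ k = (rho `^ k) ^+ n.
    by rewrite -!powR_mulrn ?powR_ge0 ?ltW // -!powRrM mulrC.
  by rewrite lerXn2r // nnegrE ?powR_ge0.
by rewrite -mulrA; lra.
Qed.

End FlatCurve.
(** * Hausdorff measures *)

Section Hausdorff.
Context {R : realType} {T : Type}.
Implicit Types (X E : set T) (d : T -> T -> R) (k eps D : R).

Lemma hausdorff_gauge_ge0 d k E : (0 <= hausdorff_gauge d k E)%E.
Proof. by rewrite /hausdorff_gauge; case: ifP => // _; exact: poweR_ge0. Qed.

Lemma hausdorff_gauge0 d k : hausdorff_gauge d k set0 = 0%E.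
Proof. by rewrite /hausdorff_gauge asboolT. Qed.

Lemma diameter_le d E D :
  (forall x y, E x -> E y -> d x y <= D) -> (diameter d E <= D%:E)%E.
Proof.
by move=> h; apply: ge_ereal_sup => _ [[x y] [/= Ex Ey] <-]; rewrite lee_fin h.
Qed.

Lemma le_diameter d E x y : E x -> E y -> ((d x y)%:E <= diameter d E)%E.
Proof. by move=> Ex Ey; apply: ereal_sup_ubound; exists (x, y). Qed.

Lemma hausdorff_gauge_le d k E D : 0 <= k -> (forall x, E x -> 0 <= d x x) ->
  (forall x y, E x -> E y -> d x y <= D) ->
  (hausdorff_gauge d k E <= (D `^ k)%:E)%E.
Proof.
move=> k0 d0 hD; rewrite /hausdorff_gauge.
case: asboolP => [_|/eqP/set0P[x Ex]].
  by rewrite lee_fin powR_ge0.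
have diam0 : (0 <= diameter d E)%E.
  by apply: le_trans (le_diameter d Ex Ex); rewrite lee_fin d0.
have D0 : 0 <= D by exact: le_trans (d0 _ Ex) (hD _ _ Ex Ex).
rewrite -poweR_EFin; apply: gt0_ler_poweR => //; last exact: diameter_le.
- by rewrite in_itv /= diam0 leey.
- by rewrite in_itv /= lee_fin D0 leey.
Qed.

Lemma hausdorff_premeasure_ge0 X d k eps E :
  (0 <= hausdorff_premeasure X d k eps E)%E.
Proof.
apply: le_ereal_inf_tmp => _ [F _ <-].
by apply: nneseries_ge0 => i _ _; exact: hausdorff_gauge_ge0.
Qed.

Lemma hausdorff_premeasure_nonincreasing X d k E eps eps' : eps <= eps' ->
  (hausdorff_premeasure X d k eps' E <= hausdorff_premeasure X d k eps E)%E.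
Proof.
move=> le; apply: ereal_inf_le_tmp => _ [F [F1 F2 F3] <-].
exists F => //; split=> // i; apply: le_trans (F3 i) _.
by rewrite lee_fin.
Qed.

(** The premeasure grows as [eps] decreases, so the limit is a supremum. *)
Lemma hausdorff_measureE X d k E : hausdorff_measure X d k E =
  ereal_sup [set hausdorff_premeasure X d k eps E | eps in `]0, +oo[].
Proof.
apply: cvg_lim => //; apply: nonincreasing_at_right_cvge => //.
by move=> x y _ _; exact: hausdorff_premeasure_nonincreasing.
Qed.

Lemma hausdorff_measure_eq0 X d k E : hausdorff_measure X d k E = 0%E <->
  forall eps, 0 < eps -> hausdorff_premeasure X d k eps E = 0%E.
Proof.
rewrite hausdorff_measureE; split=> [h eps eps0|h].
  apply/eqP; rewrite eq_le hausdorff_premeasure_ge0 andbT -h.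
  by apply: ereal_sup_ubound; exists eps; rewrite //= in_itv /= eps0.
apply/eqP; rewrite eq_le; apply/andP; split.
  by apply: ge_ereal_sup => _ [eps + <-]; rewrite /= in_itv /= andbT => /h ->.
rewrite -(h 1 ltr01); apply: ereal_sup_ubound.
by exists 1; rewrite //= in_itv /= ltr01.
Qed.

(* If [psi] parametrizes a piece of [X] by [0, 1] with inverse Hoelder of order
   [k], a cover of [X] pulls back to a cover of [0, 1], whose Lebesgue measure
   is bounded by the sum of the gauges. *)
Lemma hausdorff_measure_neq0 X d k C eps (psi : R -> T) : 0 <= k -> 0 < C ->
  0 < eps -> (forall x y, X x -> X y -> 0 <= d x y) ->
  (forall t, 0 <= t <= 1 -> X (psi t)) ->
  (forall s t, 0 <= s <= 1 -> 0 <= t <= 1 -> d (psi s) (psi t) <= eps ->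
    `|s - t| <= C * d (psi s) (psi t) `^ k) ->
  hausdorff_measure X d k X <> 0%E.
Proof.
move=> k0 C0 eps0 dge0 psiX hpsi /hausdorff_measure_eq0/(_ _ eps0) h.
(* Each [F i] pulls back into an interval of length 2 C times its gauge, so a sum below 1 / (2 C)
   would cover [[0, 1]] with total length below 1. *)
have C20 : 0 < (2 * C)^-1 by rewrite invr_gt0 mulr_gt0.
have [_ [F [F1 F2 F3] <-]] : exists2 y, [set (\sum_(0 <= i <oo)
    hausdorff_gauge d k (F i))%E | F in hausdorff_cover X d eps X] y
    & (y < ((2 * C)^-1)%:E)%E.
  apply: ereal_inf_lt.
  by rewrite -/(hausdorff_premeasure X d k eps X) h lte_fin.
move=> hF.
pose A i := [set t | 0 <= t <= 1 /\ F i (psi t)].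
(* The pullback [A i] may fail to be measurable; it is enclosed in an interval centred at one of its
   points, or in the empty set. *)
have [i|G hG] := @choice nat (set R) (fun i G => [/\ measurable G, A i `<=` G &
    (lebesgue_measure G <= (2 * C)%:E * hausdorff_gauge d k (F i))%E]).
  have [A0|/eqP/set0P[t [t01 Ft]]] := pselect (A i = set0).
    exists set0; split=> //; rewrite ?A0 // measure0.
    by rewrite mule_ge0 ?hausdorff_gauge_ge0 // lee_fin mulr_ge0 // ltW.
  have diam_ge0 : (0 <= diameter d (F i))%E.
    apply: le_trans (le_diameter d Ft Ft).
    by rewrite lee_fin dge0 //; exact: F1 Ft.
  have [D De] : exists D, diameter d (F i) = D%:E.
    exists (fine (diameter d (F i))); rewrite fineK // ge0_fin_numE //.
    exact: le_lt_trans (F3 i) (ltry _).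
  rewrite /hausdorff_gauge asboolF; last by move=> F0; rewrite F0 in Ft.
  have D_eps : D <= eps by rewrite -lee_fin -De.
  have D_ge0 : 0 <= D by rewrite -lee_fin -De.
  rewrite De poweR_EFin.
  exists `[t - C * D `^ k, t + C * D `^ k]%classic; split => //.
    move=> s [s01 Fs] /=; rewrite in_itv /=.
    have dD : d (psi s) (psi t) <= D by rewrite -lee_fin -De le_diameter.
    have : `|s - t| <= C * D `^ k.
      apply: le_trans (hpsi s t s01 t01 (le_trans dD D_eps)) _.
      rewrite ler_pM2l // ge0_ler_powR // nnegrE.
      by apply: dge0; [exact: F1 Fs|exact: F1 Ft].
    by rewrite ler_distl => /andP[]; lra.
  rewrite lebesgue_measure_itv /=; case: ifP => _.
    by rewrite -EFinB -EFinM lee_fin; lra.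
  by rewrite -EFinM lee_fin !mulr_ge0 ?powR_ge0 // ltW.
have : (lebesgue_measure (`[0%R, 1%R]%classic : set R) <=
    \sum_(0 <= i <oo) lebesgue_measure (G i))%E.
  apply: measure_sigma_subadditive => //; first by move=> i; case: (hG i).
  move=> t /=; rewrite in_itv /= => t01.
  have [i _ Fi] := F2 _ (psiX t t01).
  by exists i => //; case: (hG i) => _ + _; apply; split.
rewrite lebesgue_measure_itv /= lte_fin ltr01 sube0 leNgt => /negP; apply.
apply: (@le_lt_trans _ _
    (\sum_(0 <= i <oo) ((2 * C)%:E * hausdorff_gauge d k (F i)))%E).
  apply: lee_nneseries => [i _ _|i _]; first exact: measure_ge0.
  by case: (hG i).
rewrite nneseriesZl; last by move=> i _; exact: hausdorff_gauge_ge0.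
have C2 : 0 < 2 * C by rewrite mulr_gt0.
rewrite -lte_pdivlMl // mule1.
exact: hF.
Qed.

End Hausdorff.

(** * Hausdorff measures of a flat curve above and below exponent 1 *)

Section Dimension.
Context {R : realType} (kappa : R -> R -> R) (hflat : flat_curve kappa).
Implicit Types (k e : R).

Lemma hausdorff_measure_flat_curve_eq0 k : 1 < k ->
  hausdorff_measure `[0, 1] kappa k `[0, 1] = 0%E.
Proof.
move=> k1; have k0 : 0 <= k by lra.
apply/hausdorff_measure_eq0 => eps eps0.
apply/eqP; rewrite eq_le hausdorff_premeasure_ge0 andbT.
apply/lee_addgt0Pr => e e0; rewrite add0e.
have [d [d0 _ hsub]] := kappa_local hflat ltr01 (lexx 1).
have p0 : 0 < 4 `^ k :> R by rewrite powR_gt0.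
have ek0 : 0 < e / 4 `^ k by rewrite divr_gt0.
(* The three bounds serve, in order, for diameters at most [eps], for the use of [hsub], and for a
   sum at most [e] after the loss of 4^k. *)
pose e1 := Num.min (Num.min (eps / 4) d) (e / 4 `^ k).
have e10 : 0 < e1 by rewrite !lt_min d0 ek0 !andbT divr_gt0.
have e1eps : e1 <= eps / 4 by rewrite !ge_min lexx.
have e1d : e1 <= d by rewrite !ge_min lexx orbT.
have e1e : e1 <= e / 4 `^ k by rewrite !ge_min lexx orbT.
have [s [s1 s2 s3]] := fine_cover_unit hflat k1 e10.
pose p i := nth (0, 0) s i.
(* The finite cover is padded with empty sets, whose gauge is 0. *)
pose F i : set R :=
  if (i < size s)%N then `[(p i).1, (p i).2]%classic else set0.
have hp i : (i < size s)%N -> [/\ 0 <= (p i).1, (p i).1 <= (p i).2,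
    (p i).2 <= 1 & kappa (p i).1 (p i).2 <= e1].
  by move=> il; apply: s1; exact: mem_nth.
have FI i : F i `<=` `[0, 1].
  rewrite /F; case: ifP => [/hp[? ? ? _] x|_ x []//].
  by rewrite /= !in_itv /=; lra.
have Fk i x y : F i x -> F i y -> kappa x y <= 4 * kappa (p i).1 (p i).2.
  rewrite /F; case: ifP => [/hp[p1 p12 p2 pe]|_ []//].
  rewrite /= !in_itv /=.
  move=> /andP[x1 x2] /andP[y1 y2].
  have pd : kappa (p i).1 (p i).2 <= d by lra.
  have [xy|/ltW yx] := leP x y; first by apply: hsub.
  by rewrite (kappaC hflat); [apply: hsub|lra..].
apply: ge_ereal_inf; exists (\sum_(0 <= i <oo) hausdorff_gauge kappa k (F i))%E.
  exists F => //; split => //.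
    move=> x /=; rewrite in_itv /= => /s2[q qs qx].
    exists (index q s) => //; rewrite /F index_mem qs /= in_itv /p nth_index //.
  move=> i; rewrite /F; case: ifP => il; last first.
    by apply: diameter_le.
  apply: diameter_le => x y Fx Fy; have := Fk i x y.
  rewrite /F il => /(_ Fx Fy).
  by have [_ _ _] := hp _ il; lra.
rewrite (nneseries_split 0 (size s)); last first.
  by move=> i _; exact: hausdorff_gauge_ge0.
rewrite add0n [X in (_ + X)%E]eseries0 ?adde0; last first.
  by move=> i si _; rewrite /F ltnNge si /= hausdorff_gauge0.
apply: (@le_trans _ _ (\sum_(0 <= i < size s)
    (4 `^ k * kappa (p i).1 (p i).2 `^ k)%:E)%E).
  rewrite !big_mkord; apply: lee_sum => i _.
  have [p1 p12 p2 pe] := hp _ (ltn_ord i).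
  rewrite -powRM //; last by apply: (kappa_ge0 hflat); lra.
  apply: hausdorff_gauge_le => //; last exact: Fk.
  move=> x Fx; have := FI _ _ Fx.
  by rewrite /= in_itv /= => hx; exact: (kappa_ge0 hflat).
rewrite sumEFin lee_fin -mulr_sumr -ler_pdivlMl // mulrC.
apply: le_trans e1e; apply: le_trans s3.
by rewrite (big_nth (0, 0)).
Qed.

Lemma hausdorff_measure_flat_curve_neq0 k : 0 <= k -> k < 1 ->
  hausdorff_measure `[0, 1] kappa k `[0, 1] <> 0%E.
Proof.
move=> k0 k1.
have [psi [C [d [C0 d0 psi01 hpsi]]]] := hoelder_param hflat k0 k1.
apply: (@hausdorff_measure_neq0 _ _ _ _ _ C d psi) => //.
  by move=> x y; rewrite /= !in_itv /=; exact: kappa_ge0.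
move=> s t s01 t01 kd; have [st|/ltW ts] := leP s t.
  by rewrite distrC ger0_norm; [apply: hpsi|]; lra.
move: kd; rewrite (kappaC hflat (psi01 _ s01) (psi01 _ t01)) => kd.
by rewrite ger0_norm; [apply: hpsi|]; lra.
Qed.

End Dimension.

Theorem proposition5p3 (R : realType) (kappa : R -> R -> R)
    (hflat : flat_curve kappa) :
  hausdorff_dim `[0, 1] kappa = 1%E.
Proof.
apply/eqP; rewrite eq_le; apply/andP; split.
  (* Every exponent 1 + e gives measure zero, so the infimum is at most 1; no exponent in [0, 1)
     does, so it is at least 1. *)
  apply/lee_addgt0Pr => e e0; apply: ereal_inf_lbound; exists (1 + e) => //=.
  by split; [lra|apply: hausdorff_measure_flat_curve_eq0 => //; lra].
apply: le_ereal_inf_tmp => _ [k [k0 hk] <-]; rewrite lee_fin leNgt.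
by apply/negP => /(hausdorff_measure_flat_curve_neq0 hflat k0).
Qed.
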